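(* Let $E$ be a graded vector space, $\mu$ a (curved) $L_\infty$-structure on $E$, and $\mathcal N$ a Nijenhuis vector valued form with respect to $\mu$ with square $\mathcal K$. For $k\ge 1$ let $\mu_k:=[\mathcal N,[\mathcal N,\dots,[\mathcal N,\mu]_{RN}\dots]_{RN}]_{RN}$ ($k$ copies of $\mathcal N$). Then: (1) for all integers $k\geq 1$, $\mu_k$ is a (curved) $L_\infty$-structure on $E$, and $\mathcal N$ is Nijenhuis with square $\mathcal K$ with respect to $\mu_k$; (2) for all integers $k,l\ge 1$, $\mu_k$ and $\mu_l$ are compatible, i.e. $[\mu_k,\mu_l]_{RN}=0$.
   Context: Let $E=\oplus_{i\in\mathbb Z}E_i$ be a graded vector space over $\mathbb R$ or $\mathbb C$; $|X|$ is the degree of homogeneous $X$. A symmetric vector valued $k$-form ($k\ge0$) is a graded symmetric $k$-linear map $K:E^{k}\to E$ (exchanging adjacent arguments $X,Y$ gives the sign $(-1)^{|X||Y|}$); a $0$-form is an element of $E$. It has degree $\bar K$ if $|K(X_1,\dots,X_k)|=|X_1|+\dots+|X_k|+\bar K$. A symmetric vector valued form is a formal, possibly infinite, sum $\sum_{k\ge0}K_k$ of $k$-forms; it has degree $d$ if all $K_k$ do. For a $k$-form $K$ and $l$-form $L$, $$\iota_KL(X_1,\dots,X_{k+l-1})=\sum_{\sigma\in Sh(k,l-1)}\epsilon(\sigma)L(K(X_{\sigma(1)},\dots,X_{\sigma(k)}),X_{\sigma(k+1)},\dots,X_{\sigma(k+l-1)}),$$ with $Sh(k,l-1)$ the $(k,l-1)$-unshuffles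 and $\epsilon(\sigma)$ the Koszul sign; $\iota_KL=0$ if $l=0$, and $\iota_KL=L(K,\dots)$ if $k=0$. The Richardson–Nijenhuis bracket is $[K,L]_{RN}=\iota_KL-(-1)^{\bar K\bar L}\iota_LK$, extended bilinearly to formal sums. A curved $L_\infty$-structure on $E$ is a symmetric vector valued form $\mu=\sum_{i\ge0}l_i$ with each $l_i$ an $i$-form of degree $+1$ and $[\mu,\mu]_{RN}=0$ (equivalently, the graded Jacobi identities $\sum_{i+j=n+1}\iota_{l_i}l_j=0$ for all $n\ge0$, with $i\ge 0$, $j\ge 1$); it is an $L_\infty$-structure if $l_0=0$. ''(Curved) $L_\infty$-structure'' means an $L_\infty$-structure, possibly curved. For $\mu$ of degree $1$, a symmetric vector valued form $\mathcal N$ of degree $0$ (a $0$-form component is allowed) is Nijenhuis with respect to $\mu$ with square $\mathcal K$ if $\mathcal K$ is a symmetric vector valued form of degree $0$ with $[\mathcal N,[\mathcal N,\mu]_{RN}]_{RN}=[\mathcal K,\mu]_{RN}$ and $[\mathcal N,\mathcal K]_{RN}=0$. *)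

(* Defs.v *)
From HB Require Import structures.
From mathcomp Require Import all_boot all_order all_algebra all_fingroup.
From mathcomp Require Import boolp classical_sets functions cardinality fsbigop.
From mathcomp Require Import reals complex.

Set Implicit Arguments.
Unset Strict Implicit.
Unset Printing Implicit Defensive.
Import GRing.Theory.
Local Open Scope classical_set_scope.
Local Open Scope ring_scope.

Variant ground := RealScalars | ComplexScalars.

Definition scalars (R : realType) (g : ground) : fieldType :=
  match g with
  | RealScalars => R
  | ComplexScalars => complex R
  end.

(* [f i] is the component of [x] in [P i]. *)
Definition decomposes (F : fieldType) (V : lmodType F) (P : int -> set V)
    (x : V) (f : int -> V) : Prop :=
  [/\ forall i, P i (f i),
      finite_set [set i | f i != 0]
    & x = \sum_(i \in [set: int]) f i].

(* Internal direct sum: subspaces E_i of E such that every vector of E is in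
   a unique way a finite sum of vectors of the E_i. *)
Record gradedSpace (F : fieldType) := GradedSpace {
  gsort :> lmodType F;
  piece : int -> set gsort;
  piece0 : forall i, piece i 0;
  pieceP : forall i (c : F) (x y : gsort),
    piece i x -> piece i y -> piece i (c *: x + y);
  piece_decomp : forall x, exists! f, decomposes piece x f
}.

Section Forms.
Context {F : fieldType} {E : gradedSpace F}.

Definition hcomp (i : int) (x : E) : E := sval (cid (piece_decomp x)) i.

(* [homogeneous a s]: the vectors in [s] are homogeneous, with degrees [a]. *)
Definition homogeneous (a : seq int) (s : seq E) : Prop :=
  size a = size s /\
  forall i, (i < size s)%N -> piece (nth 0 a i) (nth 0 s i).

(* A formal sum \sum_(k >= 0) K_k of maps K_k : E^k -> E is encoded as one map
   on the disjoint union of the E^k: its restriction to sequences of length k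
   is K_k, and its value at [::] is the 0-form component. *)
Definition formal_sum := seq E -> E.

Definition multilinear (K : formal_sum) : Prop :=
  forall (s1 s2 : seq E) (c : F) (x y : E),
    K (s1 ++ (c *: x + y) :: s2) = c *: K (s1 ++ x :: s2) + K (s1 ++ y :: s2).

Definition graded_symmetric (K : formal_sum) : Prop :=
  forall (s1 s2 : seq E) (a b : int) (x y : E), piece a x -> piece b y ->
    K (s1 ++ x :: y :: s2) = (-1) ^ (a * b) *: K (s1 ++ y :: x :: s2).

Definition has_degree (d : int) (K : formal_sum) : Prop :=
  forall (a : seq int) (s : seq E), homogeneous a s ->
    piece (\sum_(i <- a) i + d) (K s).

(* Symmetric vector valued forms of degree d. *)
Definition symform (d : int) (K : formal_sum) : Prop :=
  [/\ multilinear K, graded_symmetric K & has_degree d K].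

Definition unshuffle (k n : nat) (sg : 'S_n) : bool :=
  [forall i : 'I_n, forall j : 'I_n,
     (i < j)%N && ((j < k)%N || (k <= i)%N) ==> (sg i < sg j)%N].

(* Sign relating x_0 ... x_(n-1) to x_(sg 0) ... x_(sg (n-1)) in the graded
   symmetric algebra, when x_i has degree a_i. *)
Definition koszul (n : nat) (a : n.-tuple int) (sg : 'S_n) : F :=
  \prod_(i < n) \prod_(j < n | (i < j)%N && (sg j < sg i)%N)
     (-1) ^ (tnth a (sg i) * tnth a (sg j)).

(* The value of iota_(K_k) L_(n - k + 1) at x_0, ..., x_(n-1) homogeneous of
   degrees a_0, ..., a_(n-1). *)
Definition insert_hom (K L : formal_sum) (k n : nat) (a : n.-tuple int)
    (x : n.-tuple E) : E :=
  \sum_(sg : 'S_n | unshuffle k sg)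
     koszul a sg *:
       let y := [seq tnth x (sg i) | i <- enum 'I_n] in
       L (K (take k y) :: drop k y).

(* iota_K L. The defining formula of iota_(K_k) L_l only makes sense on
   homogeneous arguments; it is extended by multilinearity, by summing over
   the homogeneous components of each argument. On n arguments the terms that
   contribute are those with k + l - 1 = n and l >= 1, so that k <= n. *)
Definition insertion (K L : formal_sum) : formal_sum := fun s =>
  let n := size s in
  \sum_(k < n.+1) \sum_(a \in [set: n.-tuple int])
     insert_hom K L k a
       [tuple hcomp (tnth a i) (tnth (in_tuple s) i) | i < n].

(* The Richardson-Nijenhuis bracket of K of degree dK and L of degree dL. The
   degrees are arguments because a map does not determine them (the zero form
   has every degree). *)
Definition rn (dK dL : int) (K L : formal_sum) : formal_sum := fun s =>
  insertion K L s - (-1) ^ (dK * dL) *: insertion L K s.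

Definition zero_form : formal_sum := fun=> 0.

(* The curvature l_0 = mu [::] is not required to vanish. *)
Definition curved_Linfty (mu : formal_sum) : Prop :=
  symform 1 mu /\ rn 1 1 mu mu = zero_form.

Definition nijenhuis (mu N K : formal_sum) : Prop :=
  [/\ symform 1 mu, symform 0 N, symform 0 K,
      rn 0 1 N (rn 0 1 N mu) = rn 0 1 K mu
    & rn 0 0 N K = zero_form].

Definition deform (N mu : formal_sum) (k : nat) : formal_sum :=
  iter k (rn 0 1 N) mu.

Lemma hcomp_decomp (x : E) : decomposes (@piece F E) x (hcomp ^~ x).
Proof. by rewrite /hcomp; case: cid => f []. Qed.

Lemma hcomp_uniq (x : E) f : decomposes (@piece F E) x f -> hcomp ^~ x = f.
Proof. by rewrite /hcomp; case: cid => g [? gu] /=; exact: gu. Qed.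

Lemma hcomp_piece i (x : E) : piece i x ->
  forall j, hcomp j x = if j == i then x else 0.
Proof.
move=> Px; suff /hcomp_uniq h : decomposes (@piece F E) x
    (fun j => if j == i then x else 0) by move=> j; rewrite -[LHS]/((hcomp ^~ x) j) h.
split.
- by move=> j; case: eqP => [->//|_]; exact: piece0.
- apply: (@sub_finite_set _ _ [set i]); last exact: finite_set1.
  by move=> j /=; case: (j =P i) => // _; rewrite eqxx.
- rewrite -(fsbig_widen [set i] setT) => [|//|j [_ /= /eqP/negPf ->]//].
  by rewrite fsbig_set1 eqxx.
Qed.

Lemma multilinear0 (K : formal_sum) : multilinear K ->
  forall s1 s2, K (s1 ++ 0 :: s2) = 0.
Proof.
by move=> mK s1 s2; have := mK s1 s2 (-1) 0 0; rewrite scaler0 addr0 scaleN1r addNr.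
Qed.

Lemma multilinear_mem0 (K : formal_sum) : multilinear K ->
  forall s, 0 \in s -> K s = 0.
Proof. by move=> mK s; case/splitPr => s1 s2; exact: multilinear0. Qed.

Lemma insert_hom0 (K L : formal_sum) : multilinear K -> multilinear L ->
  forall k n (a : n.-tuple int) (x : n.-tuple E) (i : 'I_n),
  tnth x i = 0 -> insert_hom K L k a x = 0.
Proof.
move=> mK mL k n a x i xi0; rewrite /insert_hom big1 // => sg _ /=.
set y := map _ _.
have : 0 \in y.
  by apply/mapP; exists (sg^-1%g i); rewrite ?mem_enum // permKV xi0.
rewrite -(cat_take_drop k y) mem_cat cat_take_drop => /orP[y0|y0].
  by rewrite (multilinear_mem0 mK y0) (multilinear0 mL [::]) scaler0.
by rewrite (multilinear_mem0 mL) ?scaler0 // inE y0 orbT.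
Qed.

(* On homogeneous arguments, [insertion] is given by the formula with the sum over
   unshuffles. *)
Lemma insertionE (K L : formal_sum) : multilinear K -> multilinear L ->
  forall n (a : n.-tuple int) (x : n.-tuple E), homogeneous a x ->
  insertion K L x = \sum_(k < n.+1) insert_hom K L k a x.
Proof.
move=> mK mL n a x [_ hx].
have hx' i : piece (tnth a i) (tnth x i).
  by rewrite (tnth_nth 0) (tnth_nth 0); apply: hx; rewrite size_tuple.
rewrite /insertion; case: x hx hx' => s sn _; move: sn (sn) a => /eqP sn.
case: n / sn => sn a hx; apply: eq_bigr => k _; set x := Tuple sn in hx *.
have xE i : tnth (in_tuple s) i = tnth x i by rewrite !(tnth_nth 0).
rewrite -(fsbig_widen [set a] setT) => [|//|b [_ /= ba]]; last first.
  have [i bi] : exists i, tnth b i != tnth a i.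
    apply: contra_notP ba => nb; apply: eq_from_tnth => i.
    by apply/eqP; apply: contra_notT nb => ?; exists i.
  apply: (@insert_hom0 _ _ mK mL _ _ _ _ i).
  by rewrite tnth_mktuple xE (hcomp_piece (hx i)) (negPf bi).
rewrite fsbig_set1; congr insert_hom; apply: eq_from_tnth => i.
by rewrite tnth_mktuple xE (hcomp_piece (hx i)) eqxx.
Qed.

End Forms.

Arguments formal_sum {F} E.

(* Main.v *)
Require Import Defs.
From mathcomp Require Import all_boot all_order all_algebra all_fingroup reals complex.
From mathcomp Require Import boolp classical_sets functions cardinality fsbigop.
From mathcomp Require Import zify ring.

(** Insertion of symmetric forms is composition with coderivations of the graded
    symmetric algebra, so the associator of the operation
    [(K, L) |-> insertion K L] is graded symmetric in its first two arguments: it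
    consists of the terms in which both forms are fed to the third one as separate
    arguments ([insertion_insertion], [double_insertion_comm]). This pre-Lie
    identity ([insertion_prelie]) gives the graded Jacobi identity for the
    Richardson-Nijenhuis bracket, of which only the case of one form of degree 0
    matters here ([rn_jacobi]): the bracket with [N] or with [K] is a derivation.

    To prove the pre-Lie identity, the sum over unshuffles is rewritten as a
    recursive signed sum over the splittings of a sequence ([usum],
    [sum_unshuffle]). Coassociativity and cocommutativity of that sum are short
    inductions. Since insertion of multilinear forms is multilinear
    ([insertion_multilinear]), all identities need only be checked on homogeneous
    arguments ([multilinear_ext]).

    The theorem then follows formally. Write [mu_k] for [deform N mu k] and
    [c k l] for the bracket of [mu_k] and [mu_l]. As [N] and [K] commute,
    [mu_(k+2)] is the bracket of [K] with [mu_k] ([deform_square]), which is the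
    Nijenhuis property of [N] for [mu_k]. Whenever [c k l] vanishes, the derivation
    given by [N] yields [c (k+1) l = - c k (l+1)] and the one given by [K] yields
    [c (k+2) l = - c k (l+2)]. Starting from [c 0 0 = 0], and
    with [c 1 0 = c 0 1], comparing these relations gives [2 c k l = 0] for all
    [k] and [l], by induction on [k + l] ([rn_deform]). *)

Set Implicit Arguments.
Unset Strict Implicit.
Unset Printing Implicit Defensive.
Import GRing.Theory Num.Theory.
Local Open Scope ring_scope.

(** * Koszul signs *)

Section Sign.
Context {F : fieldType}.

Lemma signD (m n : int) : (-1 : F) ^ (m + n) = (-1) ^ m * (-1) ^ n.
Proof. by rewrite expfzDr // oppr_eq0 oner_eq0. Qed.

Lemma sign_double (m : int) : (-1 : F) ^ (2 * m) = 1.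
Proof. by rewrite -exprz_exp -exprnP sqrrN expr1n exp1rz. Qed.

Lemma sign_congr (k m n : int) : m = n + 2 * k -> (-1 : F) ^ m = (-1) ^ n.
Proof. by move=> ->; rewrite signD sign_double mulr1. Qed.

Lemma sign_sum I (r : seq I) (P : pred I) (f : I -> int) :
  (-1 : F) ^ (\sum_(i <- r | P i) f i) = \prod_(i <- r | P i) (-1) ^ f i.
Proof. by apply: (big_morph (fun z : int => (-1 : F) ^ z)) => // m n; exact: signD. Qed.

End Sign.

(** * Signed sums over the splittings of a graded sequence *)

Section UnshuffleSum.
Context {F : fieldType} {T : eqType} {V : lmodType F}.
Implicit Types (t l r : seq (int * T)) (G H : seq (int * T) -> seq (int * T) -> V).

Definition tdeg t : int := \sum_(p <- t) p.1.

Lemma tdeg_nil : tdeg [::] = 0.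
Proof. exact: big_nil. Qed.

Lemma tdeg_cons p t : tdeg (p :: t) = p.1 + tdeg t.
Proof. exact: big_cons. Qed.

Lemma tdeg_cat l r : tdeg (l ++ r) = tdeg l + tdeg r.
Proof. exact: big_cat. Qed.

Lemma tdeg_perm t t' : perm_eq t t' -> tdeg t = tdeg t'.
Proof. exact: perm_big. Qed.

(** The sum of [G l r] over all ways to split [t] into two complementary
    subsequences, with the Koszul sign of moving [l] in front of [r]: the
    unshuffle coproduct of the graded symmetric algebra, evaluated on [G]. The
    first entry of [t] goes either to the left part, at no cost, or to the right
    part, past the whole left part. Its identities are proved by induction
    on [t] for all [G] at once. *)
Fixpoint usum G t : V :=
  if t is p :: t' then
    usum (fun l r => G (p :: l) r) t'
    + usum (fun l r => (-1) ^ (p.1 * tdeg l) *: G l (p :: r)) t'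
  else G [::] [::].

(** The invariant [perm_eq (l ++ r) t] is what lets degrees and homogeneity
    pass from [t] to the two parts. *)
Lemma usum_ind (Q : V -> Prop) G t :
  (forall x y, Q x -> Q y -> Q (x + y)) ->
  (forall c x, Q x -> Q (c *: x)) ->
  (forall l r, perm_eq (l ++ r) t -> Q (G l r)) -> Q (usum G t).
Proof.
move=> QD QZ; elim: t G => [|p t IH] G HG /=; first exact: HG.
apply: QD; apply: IH => l r lr; first by apply: HG; rewrite /= perm_cons.
apply: QZ; apply: HG.
by rewrite -[p :: r]cat1s perm_catCA /= perm_cons.
Qed.

Lemma eq_usum_perm G H t :
  (forall l r, perm_eq (l ++ r) t -> G l r = H l r) -> usum G t = usum H t.
Proof.
elim: t G H => [|p t IH] G H GH /=; first exact: GH.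
congr (_ + _); apply: IH => l r lr; first by apply: GH; rewrite /= perm_cons.
congr (_ *: _); apply: GH.
by rewrite -[p :: r]cat1s perm_catCA /= perm_cons.
Qed.

Lemma eq_usum G H t : (forall l r, G l r = H l r) -> usum G t = usum H t.
Proof. by move=> GH; apply: eq_usum_perm. Qed.

Lemma usumD G H t : usum (fun l r => G l r + H l r) t = usum G t + usum H t.
Proof.
elim: t G H => [|p t IH] G H //=.
under [X in _ + X]eq_usum do rewrite scalerDr.
by rewrite !IH addrACA.
Qed.

Lemma usumZ c G t : usum (fun l r => c *: G l r) t = c *: usum G t.
Proof.
elim: t G => [|p t IH] G //=.
rewrite scalerDr IH; congr (_ + _); rewrite -IH; apply: eq_usum => l r.
by rewrite !scalerA mulrC.
Qed.

(** Coassociativity of the unshuffle coproduct: both sides enumerate the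
    splittings of [t] into three parts. The first entry of [t] lands in one of the
    three; if it is the last one, the sign on the left involves the degree of the
    union of the other two, which is the sum of their degrees. *)
Lemma usum_assoc (H : seq (int * T) -> seq (int * T) -> seq (int * T) -> V) t :
  usum (fun l r => usum (fun l1 l2 => H l1 l2 r) l) t =
  usum (fun l1 r => usum (fun l2 r' => H l1 l2 r') r) t.
Proof.
elim: t H => [|p t IH] H //=.
under [X in _ = _ + X]eq_usum do rewrite scalerDr.
rewrite !usumD -addrA; congr (_ + _); first exact: IH.
congr (_ + _).
  rewrite (IH (fun l1 l2 r => (-1) ^ (p.1 * tdeg l1) *: H l1 (p :: l2) r)).
  by apply: eq_usum => l r; rewrite usumZ.
rewrite [RHS](eq_usum (H := fun l1 r => usum (fun l2 r' =>
  (-1) ^ (p.1 * (tdeg l1 + tdeg l2)) *: H l1 l2 (p :: r')) r)); last first.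
  move=> l r; rewrite -usumZ; apply: eq_usum => l2 r'.
  by rewrite mulrDr signD scalerA.
rewrite -(IH (fun l1 l2 r => (-1) ^ (p.1 * (tdeg l1 + tdeg l2)) *: H l1 l2 (p :: r))).
apply: eq_usum => l r; rewrite -usumZ; apply: eq_usum_perm => l1 l2 l12.
by rewrite -tdeg_cat (tdeg_perm l12).
Qed.

(** Graded cocommutativity of the unshuffle coproduct. *)
Lemma usum_comm G t :
  usum G t = usum (fun l r => (-1) ^ (tdeg l * tdeg r) *: G r l) t.
Proof.
elim: t G => [|p t IH] G /=; first by rewrite tdeg_nil mul0r expr0z scale1r.
rewrite addrC; congr (_ + _); rewrite IH; apply: eq_usum => l r.
  by rewrite scalerA -signD tdeg_cons; congr (_ ^ _ *: _); ring.
by rewrite scalerA -signD tdeg_cons; congr (_ *: _);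
  apply: (@sign_congr _ (- (p.1 * tdeg l))); ring.
Qed.

(** Symmetry of [G] in each part gives symmetry of the sum: when [p] and [q] land
    in the same part the symmetry of [G] applies, and the splittings that separate
    them are exchanged in pairs, with the sign coming from the crossing of the part
    boundary. *)
Lemma usum_swap G u p q t :
  (forall u' v r, G (u' ++ p :: q :: v) r =
     (-1) ^ (p.1 * q.1) *: G (u' ++ q :: p :: v) r) ->
  (forall l u' v, G l (u' ++ p :: q :: v) =
     (-1) ^ (p.1 * q.1) *: G l (u' ++ q :: p :: v)) ->
  usum G (u ++ p :: q :: t) = (-1) ^ (p.1 * q.1) *: usum G (u ++ q :: p :: t).
Proof.
elim: u G => [|z u IH] G Gl Gr /=.
  rewrite !scalerDr -!addrA -!usumZ; congr (_ + _).
    by apply: eq_usum => l r; exact: (Gl [::]).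
  rewrite [RHS]addrCA; congr (_ + _).
    apply: eq_usum => l r; rewrite !scalerA -!signD tdeg_cons; congr (_ *: _).
    by apply: (@sign_congr _ (- (p.1 * q.1))); ring.
  congr (_ + _).
    by apply: eq_usum => l r; rewrite !scalerA -!signD tdeg_cons; congr (_ ^ _ *: _); ring.
  by apply: eq_usum => l r; rewrite (Gr _ [::]) !scalerA -!signD; congr (_ ^ _ *: _); ring.
rewrite scalerDr; congr (_ + _); apply: IH.
- by move=> u' v r; exact: (Gl (z :: u')).
- by move=> l u' v; exact: Gr.
- move=> u' v r; rewrite Gl !scalerA mulrC; congr (_ * _ ^ (_ * _) *: _).
  by rewrite !tdeg_cat !tdeg_cons; ring.
- by move=> l u' v; rewrite (Gr _ (z :: u')) !scalerA mulrC.
Qed.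

Lemma usum_linear c p q w G u t : p.1 = q.1 -> p.1 = w.1 ->
  (forall u' v r, G (u' ++ p :: v) r = c *: G (u' ++ q :: v) r + G (u' ++ w :: v) r) ->
  (forall l u' v, G l (u' ++ p :: v) = c *: G l (u' ++ q :: v) + G l (u' ++ w :: v)) ->
  usum G (u ++ p :: t) = c *: usum G (u ++ q :: t) + usum G (u ++ w :: t).
Proof.
move=> pq pw; elim: u G => [|z u IH] G Gl Gr /=; rewrite scalerDr addrACA.
  congr (_ + _); rewrite -usumZ -usumD; apply: eq_usum => l r.
    exact: (Gl [::]).
  by rewrite (Gr _ [::]) -pq -pw scalerDr !scalerA mulrC.
congr (_ + _); apply: IH.
- by move=> u' v r; exact: (Gl (z :: u')).
- by move=> l u' v; exact: Gr.
- move=> u' v r; rewrite Gl scalerDr !scalerA mulrC.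
  by rewrite !tdeg_cat !tdeg_cons -pq -pw.
- by move=> l u' v; rewrite (Gr _ (z :: u')) scalerDr !scalerA mulrC.
Qed.

End UnshuffleSum.

(** * Unshuffle permutations enumerate splittings *)

Section UnshufflePermutations.

Lemma ltn_bump h m n : (bump h m < bump h n)%N = (m < n)%N.
Proof. by rewrite !ltnNge leq_bump2. Qed.

(** The position [i] of the smallest value in an unshuffle must start one of the
    two increasing blocks, so it is [0] or [k]; deleting it leaves an unshuffle.
    This matches the two cases in the recursion of [usum]. The guard [0 < k] keeps
    the cases disjoint when the first block is empty. *)
Lemma unshuffle_lift n (k : nat) (i : 'I_n.+1) (s : 'S_n) :
  (k <= n.+1)%N ->
  unshuffle k (lift_perm i ord0 s) =
  ((0 < k)%N && (i == ord0) && unshuffle k.-1 s) || ((i == k :> nat) && unshuffle k s).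
Proof.
move=> kn; apply/idP/idP.
  move=> U.
  have {}U (x y : 'I_n.+1) : (x < y)%N -> (y < k)%N || (k <= x)%N ->
      (lift_perm i ord0 s x < lift_perm i ord0 s y)%N.
    move=> xy yk; move/forallP: U => /(_ x) /forallP /(_ y) /implyP; apply.
    by rewrite xy.
  have Us (x y : 'I_n) : (x < y)%N -> (lift i y < k)%N || (k <= lift i x)%N ->
      (s x < s y)%N.
    move=> xy xyk; have := U (lift i x) (lift i y).
    by rewrite !lift_perm_lift /= !ltn_bump; exact.
  have ik : (i == ord0) || (i == k :> nat).
    have [//|i0 /=] := eqVneq i ord0; have i_gt0 : (0 < i)%N by rewrite lt0n.
    case: (ltngtP i k) => // [ik|ki].
      by have := U ord0 i i_gt0; rewrite ik lift_perm_id ltn0 => /(_ isT).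
    have kn' : (k < n.+1)%N by exact: ltn_trans ki (ltn_ord i).
    by have := U (Ordinal kn') i ki; rewrite /= leqnn orbT lift_perm_id ltn0 => /(_ isT).
  case: (posnP k) => k0 /=.
    move: ik; rewrite k0 -val_eqE /= orbb => i0; rewrite i0 /=.
    by apply/forallP => x; apply/forallP => y; apply/implyP => /andP[xy _];
       apply: Us => //; rewrite k0 leq0n orbT.
  case/orP: ik => [/eqP i0|/eqP ik].
    rewrite i0 eqxx /=; apply/orP; left.
    apply/forallP => x; apply/forallP => y; apply/implyP => /andP[xy xyk].
    apply: Us => //; rewrite i0 /= /bump; lia.
  rewrite ik eqxx; apply/orP; right.
  apply/forallP => x; apply/forallP => y; apply/implyP => /andP[xy xyk].
  apply: Us => //; rewrite /= /bump ik; lia.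
(* The two converse cases differ only in the block size [b] of [s]. *)
have cond (b : nat) : unshuffle b s ->
  (forall x y : 'I_n, (x < y)%N -> (lift i y < k)%N || (k <= lift i x)%N ->
    (y < b)%N || (b <= x)%N) ->
  (forall x : 'I_n, (lift i x < i)%N -> ((i < k)%N || (k <= lift i x)%N) = false) ->
  unshuffle k (lift_perm i ord0 s).
  move=> Ub Hb Hi; apply/forallP => x; apply/forallP => y; apply/implyP => /andP[].
  case: (unliftP i x) => [x' ->|->]; case: (unliftP i y) => [y' ->|->].
  - rewrite !lift_perm_lift [(lift i x' < _)%N]/= ltn_bump => xy xyk.
    rewrite [(lift _ _ < _)%N]/= ltn_bump.
    by move/forallP: Ub => /(_ x') /forallP /(_ y') /implyP; apply; rewrite xy Hb.
  - by move=> xi; rewrite Hi.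
  - by rewrite lift_perm_lift lift_perm_id /= /bump.
  - by rewrite ltnn.
case/orP => [/andP[/andP[k0 /eqP i0] Us]|/andP[/eqP ik Us]]; apply: (cond _ Us).
- by move=> x y xy; rewrite i0 /= /bump; lia.
- by move=> x; rewrite i0.
- by move=> x y xy; rewrite /= /bump; lia.
- by move=> x; rewrite /= /bump; lia.
Qed.

Context {F : fieldType}.

(** The inversions that involve the smallest value are exactly the ones with the
    entries placed before it. *)
Lemma koszul_lift n (c : int) (a : n.-tuple int) (i : 'I_n.+1) (s : 'S_n) :
  koszul [tuple of c :: a] (lift_perm i ord0 s) =
  (-1) ^ (c * \sum_(j < n | (j < i)%N) tnth a (s j)) * koszul a s :> F.
Proof.
rewrite /koszul (bigD1_ord i) //= [X in X * _]big1 ?mul1r; last first.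
  by move=> j; rewrite lift_perm_id ltn0 andbF.
rewrite mulr_sumr sign_sum [X in _ = X * _]big_mkcond -big_split /=.
apply: eq_bigr => j _; rewrite big_mkcond (bigD1_ord i) //=.
rewrite lift_perm_id lift_perm_lift /= andbT.
congr (_ * _).
  have -> : (bump i j < i)%N = (j < i)%N by rewrite /bump; lia.
  by case: ifP => // _; rewrite tnthS mulrC.
rewrite [RHS]big_mkcond /=; apply: eq_bigr => j' _.
rewrite !lift_perm_lift /= !ltn_bump.
by rewrite !tnthS.
Qed.

Lemma sum_lift_perm (V : nmodType) n (f : 'S_n.+1 -> V) :
  \sum_sg f sg = \sum_(i < n.+1) \sum_(s : 'S_n) f (lift_perm i ord0 s).
Proof.
rewrite pair_big /=.
apply: (reindex (fun q : 'I_n.+1 * 'S_n => lift_perm q.1 ord0 q.2)).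
apply: onW_bij; apply: inj_card_bij; last first.
  by rewrite card_prod card_ord !card_Sn factS.
move=> [i s] [i' s'] /= /permP eq_lift.
have ii' : i = i'.
  by apply: (@perm_inj _ (lift_perm i' ord0 s')); rewrite -eq_lift !lift_perm_id.
congr (_, _) => //; apply/permP => j; apply: (@lift_inj _ ord0).
by rewrite -(lift_perm_lift i) eq_lift ii' lift_perm_lift.
Qed.

Context {T : eqType} {V : lmodType F}.

Lemma map_lift_perm (A : Type) n (p : A) (t : n.-tuple A) (i : 'I_n.+1) (s : 'S_n) :
  let y := [seq tnth t (s j) | j <- enum 'I_n] in
  [seq tnth [tuple of p :: t] (lift_perm i ord0 s j) | j <- enum 'I_n.+1]
  = take i y ++ p :: drop i y.
Proof.
move=> y; have sy : size y = n by rewrite size_map size_enum_ord.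
have i_n : (i <= n)%N by rewrite -ltnS.
have nth_y (j : 'I_n) : nth p y j = tnth t (s j).
  by rewrite (nth_map j) ?size_enum_ord // nth_ord_enum.
have sti : size (take i y) = i by rewrite size_takel // sy.
have nth_bump (m : nat) : nth p (take i y ++ p :: drop i y) (bump i m) = nth p y m.
  rewrite nth_cat sti /bump; case: (leqP i m) => im.
    by rewrite add1n ltnNge (leqW im) /= subSn //= nth_drop subnKC.
  by rewrite add0n im nth_take.
apply: (@eq_from_nth _ p).
  by rewrite size_map size_enum_ord size_cat /= size_drop sti sy addnS subnKC.
move=> m; rewrite size_map size_enum_ord => mn.
rewrite -[m]/(nat_of_ord (Ordinal mn)); move: (Ordinal mn) => {m mn} j.
rewrite (nth_map j) ?size_enum_ord // nth_ord_enum.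
case: (unliftP i j) => [j' ->|->].
  by rewrite lift_perm_lift tnthS -nth_y nth_bump.
by rewrite lift_perm_id nth_cat sti ltnn subnn.
Qed.

(** Bridge between the sum over unshuffles, for all block sizes [k] at once, and
    the recursion [usum]. *)
Lemma sum_unshuffle n (t : n.-tuple (int * T)) (G : seq (int * T) -> seq (int * T) -> V) :
  \sum_(k < n.+1) \sum_(sg : 'S_n | unshuffle k sg)
    koszul (map_tuple fst t) sg *:
      (let y := [seq tnth t (sg i) | i <- enum 'I_n] in G (take k y) (drop k y))
  = usum G t.
Proof.
elim: n t G => [|n IH] t G.
  rewrite big_ord1 (tuple0 t) /= (big_pred1 1%g).
    by rewrite /koszul big_ord0 scale1r enum_ord0.
  move=> sg /=; have -> : sg = 1%g by apply/permP => -[].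
  by rewrite eqxx; apply/forallP => -[].
case/tupleP: t => p t; rewrite [RHS]/=.
pose y (s : 'S_n) := [seq tnth t (s i) | i <- enum 'I_n].
have sy s : size (y s) = n by rewrite size_map size_enum_ord.
pose Phi k (sg : 'S_n.+1) : V := koszul (map_tuple fst [tuple of p :: t]) sg *:
  (let z := [seq tnth [tuple of p :: t] (sg i) | i <- enum 'I_n.+1] in
   G (take k z) (drop k z)).
have PhiE k i s : Phi k (lift_perm i ord0 s) =
    ((-1) ^ (p.1 * tdeg (take i (y s))) * koszul (map_tuple fst t) s) *:
      G (take k (take i (y s) ++ p :: drop i (y s)))
        (drop k (take i (y s) ++ p :: drop i (y s))).
  rewrite /Phi map_lift_perm; congr (_ *: _).
  rewrite (_ : map_tuple _ _ = [tuple of p.1 :: map_tuple fst t]); last exact: val_inj.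
  rewrite koszul_lift; congr ((-1) ^ (_ * _) * _).
  have i_n : (i <= n)%N by rewrite -ltnS.
  rewrite /tdeg (big_nth p) size_takel ?sy // big_mkord.
  rewrite (big_ord_widen n (fun j => (nth p (take i (y s)) j).1) i_n).
  apply: eq_bigr => j ji; rewrite tnth_map nth_take //.
  by rewrite (nth_map j) ?size_enum_ord // nth_ord_enum.
(* Split the unshuffles according to the block that starts with the smallest
   value. *)
transitivity (\sum_(k < n.+2) \sum_(i < n.+1) \sum_(s : 'S_n)
   ((if [&& (0 < k)%N, i == ord0 & unshuffle k.-1 s] then Phi k (lift_perm i ord0 s) else 0)
   + (if (i == k :> nat) && unshuffle k s then Phi k (lift_perm i ord0 s) else 0))).
  apply: eq_bigr => k _; rewrite big_mkcond sum_lift_perm.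
  apply: eq_bigr => i _; apply: eq_bigr => s _.
  rewrite unshuffle_lift ?leq_ord // -andbA -/(Phi k _).
  case: ifP => [/orP[H1|H2]|/norP[/negPf -> /negPf ->]]; last by rewrite addr0.
    rewrite H1; case: eqP => [ik|_]; last by rewrite addr0.
    by case/and3P: H1 => k0 /eqP i0 _; rewrite -ik i0 in k0.
  rewrite H2 ifF ?add0r //; case/andP: H2 => /eqP <- _.
  by rewrite -val_eqE /=; case: posnP.
under eq_bigr do under eq_bigr do rewrite big_split.
under eq_bigr do rewrite big_split.
rewrite big_split /=; congr (_ + _).
  rewrite big_ord_recl big1 ?add0r => [|i _]; last by rewrite big1.
  rewrite -IH; apply: eq_bigr => k _.
  rewrite big_ord_recl [X in _ + X]big1 ?addr0 => [|i _]; last by rewrite big1.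
  rewrite [RHS]big_mkcond; apply: eq_bigr => s _ /=; case: ifP => // _.
  by rewrite PhiE take0 drop0 tdeg_nil mulr0 expr0z mul1r.
rewrite exchange_big -IH; apply: eq_bigr => i _.
rewrite (bigD1 (widen_ord (leqnSn _) i)) //= [X in _ + X]big1 ?addr0 => [|k]; last first.
  rewrite -val_eqE eq_sym /= => /negPf ik.
  by apply: big1 => s _; rewrite ik.
rewrite [RHS]big_mkcond eqxx; apply: eq_bigr => s _ /=; case: ifP => // _.
rewrite PhiE -/(y s); have st : size (take i (y s)) = i by rewrite size_takel // sy -ltnS.
rewrite -[in LHS](mulrC (koszul _ _)) -scalerA; congr (_ *: (_ *: _)).
by congr G; rewrite ?take_size_cat ?drop_size_cat.
Qed.
End UnshufflePermutations.

(** * Homogeneous components and multilinear extension *)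

Lemma fsbig_seqT (I : choiceType) (V : nmodType) (r : seq I) (f : I -> V) :
  uniq r -> (forall i, i \notin r -> f i = 0) ->
  (\sum_(i \in [set: I]) f i)%classic = \sum_(i <- r) f i.
Proof.
move=> ur fr; rewrite -(fsbig_widen [set` r]%classic) => [|//|i [_ /= /negP]]; last exact: fr.
by rewrite [RHS]fsbig_seq.
Qed.

Section HomogeneousComponents.
Context {F : fieldType} {E : gradedSpace F}.
Implicit Types (x y : E) (B : seq int).

(** Finite control on the homogeneous components of a vector; it allows finitely
    many vectors to share one finite set of degrees, so that sums over all degrees
    become sums over a common list. *)
Definition vanishes_off B x := forall i, i \notin B -> hcomp i x = 0.

Lemma vanishes_off_exists x : exists B, vanishes_off B x.
Proof.
have [_ /finite_seqP[B HB] _] := hcomp_decomp x; exists B => i iB.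
apply/eqP; apply: contraNT iB => xi.
by have : [set j | hcomp j x != 0]%classic i by []; rewrite HB.
Qed.

Lemma vanishes_off_sub B B' x : {subset B <= B'} -> vanishes_off B x -> vanishes_off B' x.
Proof. by move=> BB' xB i iB'; apply: xB; apply: contra iB'; exact: BB'. Qed.

Lemma vanishes_off_common (s : seq E) : exists2 B, uniq B & forall x, x \in s -> vanishes_off B x.
Proof.
suff [B HB] : exists B, forall x, x \in s -> vanishes_off B x.
  exists (undup B); first exact: undup_uniq.
  by move=> x xs; apply: vanishes_off_sub (HB _ xs) => i; rewrite mem_undup.
elim: s => [|y s [B HB]]; first by exists [::].
have [B' HB'] := vanishes_off_exists y; exists (B' ++ B) => x; rewrite inE.
case/predU1P => [->|xs]; [apply: vanishes_off_sub HB'|apply: vanishes_off_sub (HB _ xs)];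
  by move=> i; rewrite mem_cat => ->; rewrite ?orbT.
Qed.

Lemma sum_hcomp B x : uniq B -> vanishes_off B x -> x = \sum_(i <- B) hcomp i x.
Proof.
move=> uB xB; have [_ _ {1}->] := hcomp_decomp x.
exact: fsbig_seqT.
Qed.

Lemma piece_hcomp i x : piece i (hcomp i x).
Proof. by have [] := hcomp_decomp x. Qed.

Lemma hcomp_linear i (c : F) x y : hcomp i (c *: x + y) = c *: hcomp i x + hcomp i y.
Proof.
suff /hcomp_uniq H : decomposes (@piece F E) (c *: x + y)
    (fun j => c *: hcomp j x + hcomp j y) by rewrite -[LHS]/((hcomp ^~ _) i) H.
have [B uB sB] := vanishes_off_common [:: x; y].
have xB : vanishes_off B x by apply: sB; rewrite inE eqxx.
have yB : vanishes_off B y by apply: sB; rewrite !inE eqxx orbT.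
have out j : j \notin B -> c *: hcomp j x + hcomp j y = 0.
  by move=> jB; rewrite xB // yB // scaler0 addr0.
split=> [j||]; first by apply: pieceP; exact: piece_hcomp.
- apply: (@sub_finite_set _ _ [set` B]%classic); last exact: finite_seq.
  by move=> j /=; apply: contraR => /out ->.
- rewrite (fsbig_seqT uB out) big_split -scaler_sumr /=.
  by rewrite -!sum_hcomp.
Qed.

Lemma multilinear_sum (K : formal_sum E) I (r : seq I) (f : I -> E) s1 s2 :
  multilinear K ->
  K (s1 ++ \sum_(i <- r) f i :: s2) = \sum_(i <- r) K (s1 ++ f i :: s2).
Proof.
move=> mK; elim: r => [|i r IH]; first by rewrite !big_nil multilinear0.
by rewrite !big_cons -IH -[f i]scale1r mK !scale1r.
Qed.

(** A list of homogeneous arguments, each carrying its degree. *)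
Definition graded_args (t : seq (int * E)) := forall p, p \in t -> piece p.1 p.2.

Lemma graded_args_homogeneous t : graded_args t -> homogeneous (unzip1 t) (unzip2 t).
Proof.
move=> ht; split=> [|i]; rewrite !size_map // => it.
by rewrite !(nth_map (0, 0)) //; apply: ht; exact: mem_nth.
Qed.

Lemma homogeneous_graded_args a (s : seq E) : homogeneous a s -> graded_args (zip a s).
Proof.
move=> [sz h] p ps.
have si : (index p (zip a s) < size s)%N.
  by have := ps; rewrite -index_mem size_zip sz minnn.
have := h _ si; have := nth_index (0, 0) ps.
by rewrite nth_zip //; move: (index _ _) => i <-.
Qed.

(** Multilinear maps are determined by homogeneous arguments; this reduces every
    identity between forms to the setting where Koszul signs make sense. *)
Lemma multilinear_ext (f g : formal_sum E) : multilinear f -> multilinear g ->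
  (forall t, graded_args t -> f (unzip2 t) = g (unzip2 t)) -> f = g.
Proof.
move=> mf mg fg; apply/funext => s.
elim: s f g mf mg fg => [|x s IH] f g mf mg fg; first exact: (fg [::]).
have [B uB /(_ x (mem_head _ _)) xB] := vanishes_off_common [:: x].
rewrite (sum_hcomp uB xB) (multilinear_sum _ _ [::] s mf) (multilinear_sum _ _ [::] s mg).
apply: eq_bigr => i _ /=.
apply: (IH (fun s => f (hcomp i x :: s)) (fun s => g (hcomp i x :: s))).
- by move=> s1 s2; exact: (mf (_ :: s1)).
- by move=> s1 s2; exact: (mg (_ :: s1)).
- move=> t ht; apply: (fg ((i, hcomp i x) :: t)) => p.
  by rewrite inE => /predU1P[->|/ht //]; exact: piece_hcomp.
Qed.

End HomogeneousComponents.

(** * Insertion as a sum over splittings *)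

Section Insertion.
Context {F : fieldType} {E : gradedSpace F}.
Implicit Types (K L M : formal_sum E) (s : seq E) (t : seq (int * E)) (B : seq int).

(** The formula for the insertion of [K] into [L] on arguments with prescribed
    degrees, as a sum over splittings. *)
Definition isum K L t : E := usum (fun l r => L (K (unzip2 l) :: unzip2 r)) t.

(** The degrees [a] are formal labels, so this applies as well to the tuples of
    homogeneous components in the definition of [insertion]. *)
Lemma insert_hom_isum K L n (a : n.-tuple int) (x : n.-tuple E) :
  \sum_(k < n.+1) insert_hom K L k a x = isum K L (zip a x).
Proof.
pose t := [tuple of zip a x].
have at_ : map_tuple fst t = a.
  by apply: val_inj; rewrite /= -/unzip1 unzip1_zip // !size_tuple.
have xt : map_tuple snd t = x.
  by apply: val_inj; rewrite /= -/unzip2 unzip2_zip // !size_tuple.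
rewrite /isum -[zip a x]/(tval t) -sum_unshuffle at_.
apply: eq_bigr => k _; apply: eq_bigr => sg _; congr (_ *: _) => /=.
rewrite -xt /unzip2 map_take map_drop -map_comp.
rewrite (eq_map (g := snd \o (fun i => tnth t (sg i)))) // => i /=.
by rewrite tnth_map.
Qed.

Lemma insertion_isum K L t : multilinear K -> multilinear L -> graded_args t ->
  insertion K L (unzip2 t) = isum K L t.
Proof.
move=> mK mL ht; have sa : size (unzip1 t) == size t by rewrite size_map.
have sx : size (unzip2 t) == size t by rewrite size_map.
rewrite (insertionE mK mL (a := Tuple sa) (x := Tuple sx)); last exact: graded_args_homogeneous.
by rewrite insert_hom_isum /= zip_unzip.
Qed.

Lemma isum_linear K L d (c : F) (x y : E) t1 t2 : multilinear K -> multilinear L ->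
  isum K L (t1 ++ (d, c *: x + y) :: t2) =
  c *: isum K L (t1 ++ (d, x) :: t2) + isum K L (t1 ++ (d, y) :: t2).
Proof.
move=> mK mL; apply: usum_linear => // [u v r|l u v].
  by rewrite /unzip2 !map_cat /= mK (mL [::]).
by rewrite /unzip2 !map_cat /= (mL (_ :: _)).
Qed.

(** Words are plain lists rather than tuples, so that [words B (size s)] may be
    rewritten along an equality of lengths. *)
Definition words B n : seq (seq int) :=
  [seq map val (tval w) | w <- enum {: n.-tuple (seq_sub B)}].

Definition components (a : seq int) (s : seq E) : seq (int * E) :=
  [seq (p.1, hcomp p.1 p.2) | p <- zip a s].

Lemma size_words B n a : a \in words B n -> size a = n.
Proof. by case/mapP => w _ ->; rewrite size_map size_tuple. Qed.

(** Finite form of the sum over all degree tuples: a tuple with a letter outside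
    [B] selects a zero component. The right-hand side depends on [s] only through
    lists, which avoids casts between tuples whose lengths agree only
    propositionally. *)
Lemma insertion_words K L B s : multilinear K -> multilinear L ->
  uniq B -> (forall x, x \in s -> vanishes_off B x) ->
  insertion K L s = \sum_(a <- words B (size s)) isum K L (components a s).
Proof.
move=> mK mL uB sB; rewrite /insertion.
pose xs (a : (size s).-tuple int) := [tuple hcomp (tnth a i) (tnth (in_tuple s) i) | i < size s].
pose r : seq ((size s).-tuple int) :=
  [seq map_tuple val w | w <- enum {: (size s).-tuple (seq_sub B)}].
have ur : uniq r.
  rewrite map_inj_uniq ?enum_uniq // => w w' /(congr1 val) /=.
  by move/(inj_map val_inj)/val_inj.
have wr : words B (size s) = map val r by exact: (map_comp (@tval _ _) (map_tuple val)).
transitivity (\sum_(k < (size s).+1) \sum_(a <- r) insert_hom K L k a (xs a)).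
  apply: eq_bigr => k _; rewrite (fsbig_seqT ur) // => a ar.
  have [i ai] : exists i, tnth a i \notin B.
    apply/existsP; apply: contraR ar; rewrite negb_exists => /forallP aB.
    have {}aB i : tnth a i \in B by rewrite -[_ \in _]negbK; exact: aB.
    apply/mapP; exists [tuple SeqSub (aB i) | i < size s]; first by rewrite mem_enum.
    by apply: eq_from_tnth => i; rewrite tnth_map tnth_mktuple.
  apply: (@insert_hom0 _ _ _ _ mK mL _ _ _ _ i).
  by rewrite tnth_mktuple; apply: sB => //; exact: mem_tnth.
rewrite exchange_big wr [RHS]big_map; apply: eq_bigr => a _ /=.
rewrite insert_hom_isum; congr isum.
apply: (@eq_from_nth _ (0, 0)).
  by rewrite size_map !size_zip !size_tuple.
move=> m; rewrite size_zip !size_tuple minnn => sm.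
rewrite /components (nth_map (0, 0)) ?size_zip ?size_tuple ?minnn //.
rewrite !nth_zip ?size_tuple //=; congr (_, _).
transitivity (tnth (xs a) (Ordinal sm)); first by rewrite (tnth_nth 0).
by rewrite tnth_mktuple !(tnth_nth 0).
Qed.

Lemma insertion_multilinear K L : multilinear K -> multilinear L ->
  multilinear (insertion K L).
Proof.
move=> mK mL s1 s2 c x y.
(* One list of degrees serving the three argument lists makes the three sums
   run over the same words. *)
have [B uB HB] := vanishes_off_common ((c *: x + y) :: x :: y :: s1 ++ s2).
have sub z : z \in [:: c *: x + y; x; y] ->
    insertion K L (s1 ++ z :: s2) =
    \sum_(a <- words B (size s1 + (size s2).+1)) isum K L (components a (s1 ++ z :: s2)).
  move=> zin; rewrite (insertion_words mK mL uB) ?size_cat // => w ws.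
  apply: HB; move: ws zin; rewrite mem_cat !inE.
  case/or3P => [ws|/eqP ->|ws]; first by rewrite mem_cat ws !orbT.
    by case/or3P => ->; rewrite ?orbT.
  by rewrite mem_cat ws !orbT.
rewrite !sub ?inE ?eqxx ?orbT // scaler_sumr -big_split /=.
apply: eq_big_seq => a /size_words sa.
have [a1 [b [a2 [-> sa1 _]]]] : exists a1 b a2,
    [/\ a = a1 ++ b :: a2, size a1 = size s1 & size a2 = size s2].
  exists (take (size s1) a), (nth 0 a (size s1)), (drop (size s1).+1 a).
  have s1a : (size s1 < size a)%N by rewrite sa; lia.
  by rewrite -drop_nth // cat_take_drop size_drop size_takel ?(ltnW s1a) // sa; split=> //; lia.
rewrite /components !zip_cat //= !map_cat /= hcomp_linear.
exact: isum_linear.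
Qed.

End Insertion.

(** * Insertion and bracket preserve symmetric forms *)

Section Symform.
Context {F : fieldType} {E : gradedSpace F}.
Implicit Types (K L M : formal_sum E) (s : seq E) (t : seq (int * E)).

Lemma graded_args_cons p t : graded_args (p :: t) <-> piece p.1 p.2 /\ graded_args t.
Proof.
split=> [h|[hp ht] q]; last by rewrite inE => /predU1P[->|/ht].
by split=> [|q qt]; apply: h; rewrite inE ?eqxx ?qt ?orbT.
Qed.

Lemma graded_args_split l r t : perm_eq (l ++ r) t -> graded_args t ->
  graded_args l /\ graded_args r.
Proof.
move=> /perm_mem lr ht.
by split=> p pin; apply: ht; rewrite -lr mem_cat pin ?orbT.
Qed.

Lemma degree_graded_args d K t : has_degree d K -> graded_args t ->
  piece (tdeg t + d) (K (unzip2 t)).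
Proof. by move=> dK /graded_args_homogeneous/dK; rewrite big_map. Qed.

Lemma pieceD i (x y : E) : piece i x -> piece i y -> piece i (x + y).
Proof. by move=> hx hy; rewrite -[x]scale1r; exact: pieceP. Qed.

Lemma pieceZ i (c : F) (x : E) : piece i x -> piece i (c *: x).
Proof. by move=> hx; rewrite -[_ *: _]addr0; apply: pieceP => //; exact: piece0. Qed.

Lemma multilinear_catl K p : multilinear K -> multilinear (fun s => K (p ++ s)).
Proof. by move=> mK s1 s2 c x y; rewrite !catA mK. Qed.

Lemma multilinear_catr K q : multilinear K -> multilinear (fun s => K (s ++ q)).
Proof. by move=> mK s1 s2 c x y; rewrite -!catA mK. Qed.

Lemma multilinearZ K s1 s2 (c : F) (x : E) : multilinear K ->
  K (s1 ++ c *: x :: s2) = c *: K (s1 ++ x :: s2).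
Proof. by move=> mK; rewrite -[c *: x]addr0 mK multilinear0 // addr0. Qed.

Lemma multilinear_scale (c : F) K : multilinear K -> multilinear (fun s => c *: K s).
Proof. by move=> mK s1 s2 d x y; rewrite mK scalerDr !scalerA mulrC. Qed.

(** Graded symmetry concerns two homogeneous arguments [x] and [y] next to
    arbitrary others. For homogeneous neighbours it is [usum_swap]; multilinear
    extension then removes homogeneity, first on the right and then on the left. *)
Lemma insertion_symmetric K L : multilinear K -> multilinear L ->
  graded_symmetric K -> graded_symmetric L -> graded_symmetric (insertion K L).
Proof.
move=> mK mL gK gL s1 s2 a b x y ax b_y.
have mKL := insertion_multilinear mK mL.
have E1 t1 : graded_args t1 ->
    (fun s => insertion K L ((unzip2 t1 ++ [:: x; y]) ++ s)) =
    (fun s => (-1) ^ (a * b) *: insertion K L ((unzip2 t1 ++ [:: y; x]) ++ s)).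
  move=> ht1; apply: multilinear_ext; first exact: multilinear_catl.
    by apply: multilinear_scale; exact: multilinear_catl.
  move=> t2 ht2; rewrite -!catA /=.
  have eq_t u v (p q : E) : unzip2 u ++ [:: p, q & unzip2 v] =
      unzip2 (u ++ [:: (a, p), (b, q) & v]) by rewrite /unzip2 map_cat.
  have eq_t' u v (p q : E) : unzip2 u ++ [:: p, q & unzip2 v] =
      unzip2 (u ++ [:: (b, p), (a, q) & v]) by rewrite /unzip2 map_cat.
  have gcat u v : graded_args u -> graded_args v -> graded_args (u ++ v).
    by move=> hu hv p; rewrite mem_cat => /orP[/hu|/hv].
  rewrite eq_t eq_t' !insertion_isum //; last 2 first.
  - by apply: gcat => //; apply/graded_args_cons; split=> //; apply/graded_args_cons.
  - by apply: gcat => //; apply/graded_args_cons; split=> //; apply/graded_args_cons.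
  apply: (@usum_swap _ _ _ _ _ (a, x) (b, y)) => [u v r|l u v] /=.
    by rewrite -eq_t -eq_t' (gK _ _ _ _ _ _ ax b_y); exact: (multilinearZ [::]).
  by rewrite -eq_t -eq_t' (gL (_ :: _) _ _ _ _ _ ax b_y).
suff E2 : (fun s => insertion K L (s ++ [:: x, y & s2])) =
    (fun s => (-1) ^ (a * b) *: insertion K L (s ++ [:: y, x & s2])).
  by have /= := congr1 (@^~ s1) E2.
apply: multilinear_ext; first exact: multilinear_catr.
  by apply: multilinear_scale; exact: multilinear_catr.
by move=> t /E1 /(congr1 (@^~ s2)); rewrite -!catA.
Qed.

Lemma insertion_symform dK dL K L : symform dK K -> symform dL L ->
  symform (dK + dL) (insertion K L).
Proof.
move=> [mK gK hK] [mL gL hL]; split.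
- exact: insertion_multilinear.
- exact: insertion_symmetric.
move=> a s has_; have sas : size a = size s by case: has_.
have ht := homogeneous_graded_args has_.
rewrite -[s in insertion _ _ s](@unzip2_zip _ _ a) ?sas // insertion_isum //.
have -> : \sum_(i <- a) i = tdeg (zip a s).
  by rewrite -[in LHS](@unzip1_zip _ _ a s) ?sas // big_map.
apply: usum_ind => [u v|c u|l r lr]; [exact: pieceD | exact: pieceZ |].
have [hl hr] := graded_args_split lr ht.
have := degree_graded_args (t := (tdeg l + dK, K (unzip2 l)) :: r) hL.
rewrite tdeg_cons -(tdeg_perm lr) tdeg_cat /=.
rewrite [X in piece X](_ : _ = tdeg l + tdeg r + (dK + dL)); last by ring.
by apply; apply/graded_args_cons; split=> //; exact: degree_graded_args.
Qed.

(** The shape of a bracket; keeping it as one operation lets insertion distribute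
    over nested brackets by rewriting. *)
Definition comb (c : F) K L : formal_sum E := fun s => K s - c *: L s.

Lemma rnE dK dL K L :
  rn dK dL K L = comb ((-1) ^ (dK * dL)) (insertion K L) (insertion L K).
Proof. by []. Qed.

Lemma comb_multilinear c K L : multilinear K -> multilinear L -> multilinear (comb c K L).
Proof.
move=> mK mL s1 s2 d x y; rewrite /comb mK mL -!scaleNr !scalerDr addrACA.
by rewrite !scalerA [d * _]mulrC.
Qed.

Lemma comb_symform d c K L : symform d K -> symform d L -> symform d (comb c K L).
Proof.
move=> [mK gK hK] [mL gL hL]; split.
- exact: comb_multilinear.
- move=> s1 s2 a b x y ax b_y; rewrite /comb (gK _ _ _ _ _ _ ax b_y) (gL _ _ _ _ _ _ ax b_y).
  by rewrite scalerBr !scalerA [c * _]mulrC.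
- move=> a s has_; rewrite /comb -scaleNr; apply: pieceD; first exact: hK.
  by apply: pieceZ; exact: hL.
Qed.

Lemma rn_symform d dK dL K L : dK + dL = d -> symform dK K -> symform dL L ->
  symform d (rn dK dL K L).
Proof.
move=> <- sK sL; rewrite rnE; apply: comb_symform; first exact: insertion_symform.
by rewrite [dK + _]addrC; exact: insertion_symform.
Qed.

Lemma insertion_comb_l c K K' L : multilinear K -> multilinear K' -> multilinear L ->
  insertion (comb c K K') L = comb c (insertion K L) (insertion K' L).
Proof.
move=> mK mK' mL; have mc := comb_multilinear c mK mK'.
apply: multilinear_ext; first exact: insertion_multilinear.
  by apply: comb_multilinear; exact: insertion_multilinear.
move=> t ht; rewrite /comb -/(comb c K K') !insertion_isum // -scaleNr -usumZ -usumD.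
apply: eq_usum => l r; rewrite /comb -scaleNr addrC.
by rewrite (mL [::]) addrC.
Qed.

Lemma insertion_comb_r c K L L' : multilinear K -> multilinear L -> multilinear L' ->
  insertion K (comb c L L') = comb c (insertion K L) (insertion K L').
Proof.
move=> mK mL mL'; have mc := comb_multilinear c mL mL'.
apply: multilinear_ext; first exact: insertion_multilinear.
  by apply: comb_multilinear; exact: insertion_multilinear.
move=> t ht; rewrite /comb -/(comb c L L') !insertion_isum // -scaleNr -usumZ -usumD.
by apply: eq_usum => l r; rewrite /comb -scaleNr.
Qed.

End Symform.

(** * The graded pre-Lie identity and the Jacobi identity *)

Section PreLie.
Context {F : fieldType} {E : gradedSpace F}.
Implicit Types (K L M A B N : formal_sum E) (s : seq E) (t : seq (int * E)).

Lemma usum_head K G s t : multilinear K ->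
  K (usum G t :: s) = usum (fun l r => K (G l r :: s)) t.
Proof.
move=> mK; elim: t G => [|p t IH] G //=.
have := mK [::] s 1 (usum (fun l => [eta G (p :: l)]) t); rewrite /= !scale1r => ->.
rewrite !IH; congr (_ + _); apply: eq_usum => l r.
exact: (multilinearZ [::]).
Qed.

Lemma usum_comm_first_two (H : seq (int * E) -> seq (int * E) -> seq (int * E) -> E) t :
  usum (fun l r => usum (fun l' r' => H l l' r') r) t =
  usum (fun l r => usum (fun l' r' => (-1 : F) ^ (tdeg l * tdeg l') *: H l' l r') r) t.
Proof.
rewrite -usum_assoc -(usum_assoc (fun l l' r => (-1 : F) ^ (tdeg l * tdeg l') *: H l' l r)).
by apply: eq_usum => m r; rewrite usum_comm.
Qed.

(** The terms of [insertion K (insertion L M)] in which the outputs of [K] and of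
    [L] are two separate arguments of [M], up to the sign [(-1) ^ (dL * dK)]. *)
Definition double_insertion (dL : int) K L M t : E :=
  usum (fun l r => usum (fun l' r' =>
    (-1) ^ (dL * tdeg l) *: M [:: K (unzip2 l), L (unzip2 l') & unzip2 r']) r) t.

(** Exchanging the blocks fed to [K] and to [L], then the first two arguments of
    [M], costs a sign that depends only on the degrees of [K] and [L]. *)
Lemma double_insertion_comm dK dL dM K L M t :
  symform dK K -> symform dL L -> symform dM M -> graded_args t ->
  (-1) ^ (dL * dK) *: double_insertion dL K L M t = double_insertion dK L K M t.
Proof.
move=> [mK gK hK] [mL gL hL] [mM gM hM] ht.
rewrite /double_insertion [RHS]usum_comm_first_two -usumZ.
apply: eq_usum_perm => l r /graded_args_split /(_ ht) [hl hr].
rewrite -usumZ; apply: eq_usum_perm => l' r' /graded_args_split /(_ hr) [hl' hr'].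
rewrite (gM [::] _ _ _ _ _ (degree_graded_args hL hl') (degree_graded_args hK hl)).
rewrite !scalerA -!signD /=; congr (_ *: _).
apply: (@sign_congr _ (- (tdeg l * tdeg l') - dK * tdeg l')); ring.
Qed.

(** When [L] is inserted into [M] after [K] has been applied, the output of [K]
    is either an argument of [L], which by coassociativity gives
    [insertion (insertion K L) M], or a direct argument of [M]. *)
Lemma insertion_insertion dK dL dM K L M t :
  symform dK K -> symform dL L -> symform dM M -> graded_args t ->
  insertion K (insertion L M) (unzip2 t) =
  insertion (insertion K L) M (unzip2 t) + (-1) ^ (dL * dK) *: double_insertion dL K L M t.
Proof.
move=> [mK gK hK] [mL gL hL] [mM gM hM] ht.
have mKL := insertion_multilinear mK mL.
have mLM := insertion_multilinear mL mM.
rewrite !insertion_isum // /isum /double_insertion -usumZ.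
rewrite [X in _ = X + _](eq_usum_perm (H := fun l r => usum (fun l1 l2 =>
    M (L (K (unzip2 l1) :: unzip2 l2) :: unzip2 r)) l)); last first.
  move=> l r /graded_args_split /(_ ht) [hl hr].
  rewrite insertion_isum // /isum.
  exact: usum_head.
rewrite (usum_assoc (fun l1 l2 r => M (L (K (unzip2 l1) :: unzip2 l2) :: unzip2 r))).
rewrite -usumD; apply: eq_usum_perm => l r /graded_args_split /(_ ht) [hl hr].
have hKl := degree_graded_args hK hl.
rewrite -[K (unzip2 l) :: _]/(unzip2 ((tdeg l + dK, K (unzip2 l)) :: r)).
rewrite insertion_isum //; last by apply/graded_args_cons.
rewrite /isum /=; congr (_ + _); rewrite -usumZ.
apply: eq_usum_perm => l' r' /graded_args_split /(_ hr) [hl' hr'].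
rewrite (gM [::] _ _ _ _ _ (degree_graded_args hL hl') hKl).
rewrite !scalerA -!signD /=; congr (_ *: _).
apply: (@sign_congr _ ((tdeg l + dK) * tdeg l')); ring.
Qed.

(** The associator of insertion is the doubly inserted part, hence graded
    symmetric in [K] and [L]. *)
Lemma insertion_prelie dK dL dM K L M :
  symform dK K -> symform dL L -> symform dM M ->
  comb 1 (insertion K (insertion L M)) (insertion (insertion K L) M) =
  (fun s => (-1) ^ (dK * dL) *:
     comb 1 (insertion L (insertion K M)) (insertion (insertion L K) M) s).
Proof.
move=> sK sL sM; have [mK _ _] := sK; have [mL _ _] := sL; have [mM _ _] := sM.
have mi K' L' : multilinear K' -> multilinear L' -> multilinear (insertion K' L') :=
  @insertion_multilinear F E K' L'.
apply: multilinear_ext.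
- by apply: comb_multilinear; apply: (mi) => //; apply: mi.
- by apply: multilinear_scale; apply: comb_multilinear; apply: (mi) => //; apply: mi.
move=> t ht; rewrite /comb !scale1r.
rewrite (insertion_insertion sK sL sM ht) (insertion_insertion sL sK sM ht).
rewrite ![_ + _ - _]addrAC !subrr !add0r (double_insertion_comm sK sL sM ht) scalerA -signD.
by rewrite (_ : _ + _ = 2 * (dK * dL)) ?sign_double ?scale1r //; ring.
Qed.

(** Bracketing with a form of degree 0 is a derivation of the bracket: expand all
    brackets into insertions and use the pre-Lie identity for the three triples
    [(N, A, B)], [(N, B, A)] and [(A, B, N)]. *)
Lemma rn_jacobi a b N A B s : symform 0 N -> symform a A -> symform b B ->
  rn 0 (a + b) N (rn a b A B) s =
  rn a b (rn 0 a N A) B s + rn a b A (rn 0 b N B) s.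
Proof.
move=> sN sA sB; have [mN _ _] := sN; have [mA _ _] := sA; have [mB _ _] := sB.
have mi := @insertion_multilinear F E.
rewrite !rnE !insertion_comb_l ?insertion_comb_r //; try exact: mi.
have /(congr1 (@^~ s)) := insertion_prelie sN sA sB.
have /(congr1 (@^~ s)) := insertion_prelie sN sB sA.
have /(congr1 (@^~ s)) := insertion_prelie sA sB sN.
rewrite /comb !mul0r !expr0z !scale1r.
move=> pABN pNBA pNAB.
have -> : insertion N (insertion A B) s = insertion A (insertion N B) s
    - insertion (insertion A N) B s + insertion (insertion N A) B s.
  by rewrite -pNAB subrK.
have -> : insertion N (insertion B A) s = insertion B (insertion N A) s
    - insertion (insertion B N) A s + insertion (insertion N B) A s.
  by rewrite -pNBA subrK.
have -> : insertion (insertion A B) N s - (-1) ^ (a * b) *: insertion (insertion B A) N s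
    = insertion A (insertion B N) s - (-1) ^ (a * b) *: insertion B (insertion A N) s.
  have -> : insertion A (insertion B N) s = _ := canRL (subrK _) pABN.
  by rewrite scalerBr [RHS](ACl (1 * 4 * 3 * 2)) /= subrr add0r.
(* Both sides are now flat sums of the same eight terms. *)
rewrite !(scalerBr, scalerDr, opprB, opprD, addrA, opprK).
by rewrite [LHS](ACl (3 * 2 * 7 * 5 * 1 * 8 * 4 * 6)).
Qed.

End PreLie.

(** * The hierarchy of deformed structures *)

Lemma eq_opp0 (F : fieldType) (V : lmodType F) (x : V) : (2%:R : F) != 0 -> x = - x -> x = 0.
Proof.
move=> two0 /eqP; rewrite -addr_eq0 -mulr2n -scaler_nat scaler_eq0 (negPf two0).
by move/eqP.
Qed.

Section Deformation.
Context {F : fieldType} {E : gradedSpace F}.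
Implicit Types (K A B N mu : formal_sum E).

Lemma zero_multilinear : multilinear (@zero_form F E).
Proof. by move=> s1 s2 c x y; rewrite /zero_form scaler0 addr0. Qed.

Lemma insertion_zero_l L : multilinear L -> insertion (@zero_form F E) L = @zero_form F E.
Proof.
move=> mL; have m0 := zero_multilinear.
apply: multilinear_ext => // [|t ht]; first exact: insertion_multilinear.
rewrite insertion_isum //; apply: (usum_ind (Q := eq^~ (0 : E))).
- by move=> x y -> ->; rewrite addr0.
- by move=> c x ->; rewrite scaler0.
- by move=> l r _; exact: (multilinear0 mL [::]).
Qed.

Lemma insertion_zero_r K : multilinear K -> insertion K (@zero_form F E) = @zero_form F E.
Proof.
move=> mK; have m0 := zero_multilinear.
apply: multilinear_ext => // [|t ht]; first exact: insertion_multilinear.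
rewrite insertion_isum //; apply: (usum_ind (Q := eq^~ (0 : E))) => //.
- by move=> x y -> ->; rewrite addr0.
- by move=> c x ->; rewrite scaler0.
Qed.

Lemma rn_zero_r dK dL K : multilinear K -> rn dK dL K (@zero_form F E) = @zero_form F E.
Proof.
move=> mK; apply/funext => s; rewrite /rn insertion_zero_l // insertion_zero_r //.
by rewrite /zero_form scaler0 subr0.
Qed.

Lemma rn_zero_l dK dL L : multilinear L -> rn dK dL (@zero_form F E) L = @zero_form F E.
Proof.
move=> mL; apply/funext => s; rewrite /rn insertion_zero_l // insertion_zero_r //.
by rewrite /zero_form scaler0 subr0.
Qed.

Lemma deform_symform N mu k : symform 0 N -> symform 1 mu -> symform 1 (deform N mu k).
Proof. by move=> sN smu; elim: k => //= k IH; apply: rn_symform IH. Qed.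

Lemma rn_commute N K A : symform 0 N -> symform 0 K -> symform 1 A ->
  rn 0 0 N K = @zero_form F E ->
  rn 0 1 N (rn 0 1 K A) = rn 0 1 K (rn 0 1 N A).
Proof.
move=> sN sK sA NK; apply/funext => s; have [mA _ _] := sA.
have := rn_jacobi s sN sK sA; rewrite NK (rn_zero_l _ _ mA) add0r => ->.
by rewrite /zero_form add0r.
Qed.

(** Since [N] and [K] commute, so do their adjoint actions, and the relation
    between [N], [K] and [mu] propagates along the hierarchy. *)
Lemma deform_square N mu K k : nijenhuis mu N K ->
  deform N mu k.+2 = rn 0 1 K (deform N mu k).
Proof.
move=> [smu sN sK sq NK]; elim: k => [|k IH] //.
rewrite -[LHS]/(rn 0 1 N (deform N mu k.+2)) IH rn_commute //.
exact: deform_symform.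
Qed.

(** A derivation applied to a vanishing bracket. *)
Lemma rn_skew P A B s : symform 0 P -> symform 1 A -> symform 1 B ->
  rn 1 1 A B = @zero_form F E ->
  rn 1 1 (rn 0 1 P A) B s = - rn 1 1 A (rn 0 1 P B) s.
Proof.
move=> sP sA sB AB; have [mP _ _] := sP.
have := rn_jacobi s sP sA sB; rewrite AB (rn_zero_r _ _ mP) => /esym /eqP.
by rewrite addr_eq0 => /eqP.
Qed.

Lemma rn_sym_degree1 A B s : rn 1 1 A B s = rn 1 1 B A s.
Proof. by rewrite /rn mulr1 expr1z !scaleN1r !opprK addrC. Qed.

(** Induction on the total index [k + l] of the bracket [c k l] of the [k]-th and
    the [l]-th deformation. Suppose that the brackets of total index [n] and
    [n + 1] vanish, and let [k + l = n]. The derivation given by [N], applied to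
    [c k.+1 l] and to [c k l.+1], yields [c k.+2 l = c k l.+2]; the one given by
    [K], applied to [c k l], yields [c k.+2 l = - c k l.+2]. So both are zero. Total
    index 1 uses instead the symmetry of the bracket in degree 1. *)
Lemma rn_deform N mu K : (2%:R : F) != 0 -> curved_Linfty mu -> nijenhuis mu N K ->
  forall k l, rn 1 1 (deform N mu k) (deform N mu l) = @zero_form F E.
Proof.
move=> two0 [_ mu2] nij; have [smu sN sK _ _] := nij.
have sd k := deform_symform k sN smu.
pose c k l := rn 1 1 (deform N mu k) (deform N mu l).
have cN k l s : c k l = @zero_form F E -> c k.+1 l s = - c k l.+1 s.
  by move=> ckl; apply: rn_skew.
have cK k l s : c k l = @zero_form F E -> c k.+2 l s = - c k l.+2 s.
  by move=> ckl; rewrite /c !(deform_square _ nij); exact: rn_skew.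
suff H n : forall k l, (k + l = n)%N -> c k l = @zero_form F E.
  by move=> k l; exact: H erefl.
suff [] : (forall k l, (k + l = n)%N -> c k l = @zero_form F E) /\
    (forall k l, (k + l = n.+1)%N -> c k l = @zero_form F E) by [].
elim: n => [|n [IH0 IH1]]; split=> //.
- by case=> [|//] [|//] _.
- have c10 s : c 1%N 0%N s = 0.
    by apply: eq_opp0 => //; rewrite {1}(cN 0%N 0%N) // /c rn_sym_degree1.
  case=> [|[|//]] [|[|//]] // _; apply/funext => s; last exact: c10.
  by rewrite /c rn_sym_degree1; exact: c10.
- have c2 k l : (k + l = n)%N -> c k.+2 l = @zero_form F E.
    move=> kl; apply/funext => s; apply: eq_opp0 => //.
    rewrite {1}cK; last exact: IH0.
    by congr (- _); rewrite !cN ?opprK //; apply: IH1; lia.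
  have c1 s : c 1%N n.+1 s = 0.
    by apply: oppr_inj; rewrite -cN ?c2 ?oppr0 //; exact: IH1.
  case=> [|[|k]] l kl.
  + apply/funext => s; rewrite (_ : l = n.+2) //.
    by apply: oppr_inj; rewrite -cN ?c1 ?oppr0 //; exact: IH1.
  + by apply/funext => s; rewrite (_ : l = n.+1) ?c1 //; lia.
  + by apply: c2; lia.
Qed.

End Deformation.

Lemma scalars_two_neq0 (R : realType) (g : ground) : (2%:R : scalars R g) != 0.
Proof. by case: g; rewrite /= pnatr_eq0. Qed.

Theorem theorem2p3p10 (R : realType) (g : ground) (E : gradedSpace (scalars R g))
    (mu N K : formal_sum E)
    (mu_Linfty : curved_Linfty mu)
    (N_nijenhuis : nijenhuis mu N K) :
  (forall k : nat, (1 <= k)%N ->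
     curved_Linfty (deform N mu k) /\ nijenhuis (deform N mu k) N K) /\
  (forall k l : nat, (1 <= k)%N -> (1 <= l)%N ->
     rn 1%R 1%R (deform N mu k) (deform N mu l) = zero_form).
Proof.
have [smu sN sK _ NK] := N_nijenhuis.
have zero := rn_deform (scalars_two_neq0 R g) mu_Linfty N_nijenhuis.
have sd k := deform_symform k sN smu.
split=> [k _|k l _ _]; last exact: zero.
split; first by split; [exact: sd | exact: zero].
exact: And5 (sd k) sN sK (deform_square k N_nijenhuis) NK.
Qed.
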